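(* Let $1<p\le\infty$ and let $X$ be a Banach space. The following statements are equivalent: (i) $X$ has the $p$-$(DPrcP)$. (ii) $X$ has the $(SR)_{1,p}$ property and $X$ contains no isomorphic copy of $c_0$.
   Context: For $1\le r\le\infty$: a sequence $(x_n)_n$ in a Banach space $X$ is weakly $r$-summable if $(x^{*}(x_n))_n\in\ell_r$ for every $x^{*}\in X^{*}$ when $r<\infty$; weakly $\infty$-summable means weakly null. A bounded subset $K\subseteq X$ is a Dunford-Pettis set if every weakly null sequence in $X^{*}$ converges to zero uniformly on $K$. A sequence in $X$ is $r$-Right null if it is weakly $r$-summable and its set of terms is a Dunford-Pettis set. $X$ has the $r$-Dunford-Pettis relatively compact property ($r$-$(DPrcP)$) if every $r$-Right null sequence in $X$ is norm null. A bounded subset $K\subseteq X^{*}$ is an $r$-Right set if $\lim_n\sup_{x^{*}\in K}|x^{*}(x_n)|=0$ for every $r$-Right null sequence $(x_n)_n$ in $X$. For $1\le r<s\le\infty$, $X$ has the $(SR)_{r,s}$ property if every $r$-Right set in $X^{*}$ is an $s$-Right set in $X^{*}$. *)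

(* Defs.v *)
From HB Require Import structures.
From mathcomp Require Import all_boot all_order all_algebra.
From mathcomp Require Import complex.
From mathcomp Require Import all_classical all_reals all_analysis.

Set Implicit Arguments.
Unset Strict Implicit.
Unset Printing Implicit Defensive.

Import Order.TTheory GRing.Theory Num.Theory.
Import numFieldNormedType.Exports.

Local Open Scope classical_set_scope.
Local Open Scope ring_scope.

Variant scalar_kind := RealScalars | ComplexScalars.

Section Scalars.
Variables (R : realType) (k : scalar_kind).

Definition scalars : numFieldType :=
  match k with RealScalars => R | ComplexScalars => R[i] end.

(* The norm of a [normedModType (scalars R k)] takes its values in [scalars R k];
   [toR] and [ofR] identify the real scalars with [R]. *)
Definition toR : scalars -> R :=
  match k return (match k with RealScalars => R : numFieldType
                             | ComplexScalars => R[i] end) -> R with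
  | RealScalars => id
  | ComplexScalars => @complex.Re R
  end.

Definition ofR : R -> scalars :=
  match k return R -> (match k with RealScalars => R : numFieldType
                                  | ComplexScalars => R[i] end) with
  | RealScalars => id
  | ComplexScalars => fun x => Complex x 0
  end.

End Scalars.
Arguments toR {R k}.
Arguments ofR {R k}.

Section ScalarsTheory.
Variables (R : realType) (k : scalar_kind).
Local Notation K := (scalars R k).

Lemma ofRK : cancel (@ofR R k) toR.
Proof. by case: k. Qed.

Lemma toRK (x : K) : 0 <= x -> ofR (toR x) = x.
Proof.
case: k x => //= -[a b].
by rewrite lecE /= => /andP[/eqP -> _].
Qed.

Lemma ofRD (x y : R) : ofR (x + y) = ofR x + ofR y :> K.
Proof. by case: k => //; exact: rmorphD (real_complex R) x y. Qed.

Lemma ofRM (x y : R) : ofR (x * y) = ofR x * ofR y :> K.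
Proof. by case: k => //; exact: rmorphM (real_complex R) x y. Qed.

Lemma ler_ofR (x y : R) : (ofR x <= ofR y :> K) = (x <= y).
Proof. by case: k => //; exact: lecR. Qed.

Lemma ofR0 : ofR 0 = 0 :> K. Proof. by case: k. Qed.

End ScalarsTheory.

Section RealNorm.
Variables (R : realType) (k : scalar_kind) (V : normedModType (scalars R k)).
Local Notation K := (scalars R k).
Implicit Types (x y : V).

Definition rnorm x : R := toR `|x|.

Lemma ofR_rnorm x : ofR (rnorm x) = `|x|.
Proof. exact: toRK. Qed.

Lemma ler_rnorm_ofR x (r : R) : (rnorm x <= r) = (`|x| <= ofR r).
Proof. by rewrite -ofR_rnorm ler_ofR. Qed.

Lemma rnorm0 : rnorm 0 = 0.
Proof. by apply: (can_inj (@ofRK R k)); rewrite ofR_rnorm normr0 ofR0. Qed.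

Lemma rnorm_ge0 x : 0 <= rnorm x.
Proof. by rewrite -(ler_ofR k) ofR0 ofR_rnorm. Qed.

Lemma rnorm_eq0 x : rnorm x = 0 -> x = 0.
Proof. by move=> x0; apply/normr0_eq0; rewrite -ofR_rnorm x0 ofR0. Qed.

Lemma ler_rnormD x y : rnorm (x + y) <= rnorm x + rnorm y.
Proof. by rewrite ler_rnorm_ofR ofRD !ofR_rnorm ler_normD. Qed.

End RealNorm.

Section Scale.
Variables (R : realType) (k : scalar_kind) (V : normedModType (scalars R k)).
Local Notation K := (scalars R k).

Lemma rnormZ (l : K) (x : V) :
  rnorm (l *: x) = rnorm (l : K^o) * rnorm x.
Proof.
by apply: (can_inj (@ofRK R k)); rewrite ofRM !ofR_rnorm normrZ.
Qed.

End Scale.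

(* Shared by the norms of the dual space and of c_0. *)
Section SupNorm.
Variables (R : realType) (k : scalar_kind) (I : Type) (D : set I).
Local Notation K := (scalars R k).
Implicit Types (f g : I -> K^o).

Definition supnorm f : R := sup [set rnorm (f i) | i in D].

Hypothesis D0 : D !=set0.

Definition bounded_on f := exists M : R, forall i, D i -> rnorm (f i) <= M.

Lemma supnorm_ub f i : bounded_on f -> D i -> rnorm (f i) <= supnorm f.
Proof.
move=> [M fM] Di; apply: ub_le_sup; last by exists i.
by exists M => _ [j Dj <-]; exact: fM.
Qed.

Lemma supnorm_le f (r : R) :
  (forall i, D i -> rnorm (f i) <= r) -> supnorm f <= r.
Proof.
move=> fr; apply: ge_sup; last by move=> _ [i Di <-]; exact: fr.
by case: D0 => i Di; exists (rnorm (f i)), i.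
Qed.

Lemma supnormD f g : bounded_on f -> bounded_on g ->
  supnorm (f \+ g) <= supnorm f + supnorm g.
Proof.
move=> bf bg; apply: supnorm_le => i Di.
by apply: le_trans (ler_rnormD _ _) _; apply: lerD; exact: supnorm_ub.
Qed.

Lemma bounded_onZ (l : K) f : bounded_on f -> bounded_on (l \*: f).
Proof.
move=> [M fM]; exists (rnorm (l : K^o) * M) => i Di /=.
by rewrite rnormZ ler_wpM2l ?rnorm_ge0 ?fM.
Qed.

Lemma supnormZ (l : K) f : bounded_on f ->
  supnorm (l \*: f) = rnorm (l : K^o) * supnorm f.
Proof.
have le m g : bounded_on g -> supnorm (m \*: g) <= rnorm (m : K^o) * supnorm g.
  move=> bg; apply: supnorm_le => i Di /=.
  by rewrite rnormZ ler_wpM2l ?rnorm_ge0 ?supnorm_ub.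
move=> bf; apply/eqP; rewrite eq_le le //=.
have [->|l0] := eqVneq l 0.
  rewrite [rnorm _]rnorm0 mul0r.
  have [i Di] := D0; apply: le_trans (rnorm_ge0 _) (supnorm_ub _ Di).
  exact: bounded_onZ.
have := le l^-1 (l \*: f) (bounded_onZ l bf).
have -> : l^-1 \*: (l \*: f) = f.
  by apply/funext => i /=; rewrite scalerA mulVf// scale1r.
have ln : rnorm (l : K^o) * rnorm (l^-1 : K^o) = 1.
  rewrite -rnormZ /GRing.scale /= divff//.
  by apply: (can_inj (@ofRK R k)); rewrite ofR_rnorm normr1; case: k.
move=> /(ler_wpM2l (rnorm_ge0 (l : K^o))).
by rewrite mulrA ln mul1r.
Qed.

Lemma supnorm_eq0 f : bounded_on f -> supnorm f = 0 ->
  forall i, D i -> f i = 0.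
Proof.
move=> bf f0 i Di; apply/rnorm_eq0/eqP; rewrite eq_le rnorm_ge0 andbT -f0.
exact: supnorm_ub.
Qed.

End SupNorm.

Section Dual.
Variables (R : realType) (k : scalar_kind) (V : normedModType (scalars R k)).
Local Notation K := (scalars R k).

Definition dual_pred : {pred V -> K^o} :=
  fun f => `[< linear f /\ continuous f >].

Record dual := Dual { dual_fun :> V -> K^o; _ : dual_fun \in dual_pred }.

HB.instance Definition _ := [isSub for dual_fun].
HB.instance Definition _ := gen_eqMixin dual.
HB.instance Definition _ := gen_choiceMixin dual.

Lemma dual_submod_closed : submod_closed dual_pred.
Proof.
split=> [|l f g /asboolP[lf cf] /asboolP[lg cg]]; apply/asboolP; split.
- by move=> a x y; rewrite /= scaler0 addr0.
- by move=> x; exact: cvg_cst.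
- move=> a x y; rewrite !fctE /= lf lg !scalerDr !scalerA (mulrC l).
  by rewrite addrACA.
- move=> x; apply: cvgD; [apply: cvgZl_tmp; exact: cf|exact: cg].
Qed.
HB.instance Definition _ := GRing.isSubmodClosed.Build K (V -> K^o) dual_pred
  dual_submod_closed.
HB.instance Definition _ := [SubChoice_isSubLmodule of dual by <:].

Lemma dual_linear (f : dual) : linear f.
Proof. by case: f => f /= /asboolP[]. Qed.

Lemma dual_continuous (f : dual) : continuous f.
Proof. by case: f => f /= /asboolP[]. Qed.

HB.instance Definition _ (f : dual) :=
  GRing.isLinear.Build K V K^o *:%R f (dual_linear f).

Definition unit_ball : set V := [set x | `|x| <= 1].

Definition dual_norm (f : dual) : K := ofR (supnorm unit_ball f).

Let unit_ball0 : unit_ball !=set0.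
Proof. by exists 0; rewrite /unit_ball /= normr0. Qed.

Let dual_bounded (f : dual) : bounded_on unit_ball f.
Proof.
have /linear_boundedP := continuous_linear_bounded 0 (@dual_continuous f 0).
move=> /pinfty_ex_gt0[M M0 fM].
exists (toR M) => x x1; rewrite ler_rnorm_ofR toRK ?(ltW M0)//.
by apply: (le_trans (fM x)); rewrite ler_piMr ?(ltW M0).
Qed.

Let dual_normD (f g : dual) : dual_norm (f + g) <= dual_norm f + dual_norm g.
Proof. by rewrite -ofRD ler_ofR; exact: supnormD. Qed.

Let dual_normZ (l : K) (f : dual) : dual_norm (l *: f) = `|l| * dual_norm f.
Proof. by rewrite /dual_norm -(@ofR_rnorm _ _ K^o) -ofRM -supnormZ. Qed.

Let dual_norm0_eq0 (f : dual) : dual_norm f = 0 -> f = 0.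
Proof.
rewrite /dual_norm -(ofR0 R k) => /(can_inj (@ofRK R k)) f0.
have {}f0 := supnorm_eq0 (dual_bounded f) f0.
apply/val_inj/funext => x /=.
have [->|x0] := eqVneq x 0; first exact: linear0.
have := f0 (`|x|^-1 *: x); rewrite linearZ /=.
rewrite /unit_ball /= normrZ normfV normr_id mulVf ?normr_eq0//.
move=> /(_ (lexx _))/eqP; rewrite scaler_eq0 invr_eq0 normr_eq0.
by rewrite (negbTE x0) => /eqP.
Qed.

HB.instance Definition _ :=
  Lmodule_isNormed.Build K dual dual_normD dual_normZ dual_norm0_eq0.

End Dual.

Section C0.
Variables (R : realType) (k : scalar_kind).
Local Notation K := (scalars R k).

Definition c0_pred : {pred nat -> K^o} :=
  fun z => `[< z n @[n --> \oo] --> (0 : K^o) >].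

Record c0 := C0 { c0_fun :> nat -> K^o; _ : c0_fun \in c0_pred }.

HB.instance Definition _ := [isSub for c0_fun].
HB.instance Definition _ := gen_eqMixin c0.
HB.instance Definition _ := gen_choiceMixin c0.

Lemma c0_submod_closed : submod_closed c0_pred.
Proof.
split=> [|l z w /asboolP zc /asboolP wc]; apply/asboolP; first exact: cvg_cst.
rewrite -[X in _ --> X]addr0 -[X in _ --> X + _](scaler0 K^o l).
by apply: cvgD => //; exact: cvgZl_tmp.
Qed.
HB.instance Definition _ := GRing.isSubmodClosed.Build K (nat -> K^o) c0_pred
  c0_submod_closed.
HB.instance Definition _ := [SubChoice_isSubLmodule of c0 by <:].

Definition c0_norm (z : c0) : K := ofR (supnorm setT z).

Let c0_bounded (z : c0) : bounded_on setT z.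
Proof.
have zc : z n @[n --> \oo] --> (0 : K^o) by case: z => z /= /asboolP.
have /cvg_seq_bounded : cvgn z by apply/cvg_ex; exists 0.
move=> /pinfty_ex_gt0[M M0 zM]; exists (toR M) => n _.
by rewrite ler_rnorm_ofR toRK ?(ltW M0)//; exact: zM.
Qed.

Let nat0 : [set: nat] !=set0. Proof. by exists 0%N. Qed.

Let c0_normD (z w : c0) : c0_norm (z + w) <= c0_norm z + c0_norm w.
Proof. by rewrite -ofRD ler_ofR; exact: supnormD. Qed.

Let c0_normZ (l : K) (z : c0) : c0_norm (l *: z) = `|l| * c0_norm z.
Proof. by rewrite /c0_norm -(@ofR_rnorm _ _ K^o) -ofRM -supnormZ. Qed.

Let c0_norm0_eq0 (z : c0) : c0_norm z = 0 -> z = 0.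
Proof.
rewrite /c0_norm -(ofR0 R k) => /(can_inj (@ofRK R k)) z0.
by apply/val_inj/funext => n /=; exact: (supnorm_eq0 (c0_bounded z) z0).
Qed.

HB.instance Definition _ :=
  Lmodule_isNormed.Build K c0 c0_normD c0_normZ c0_norm0_eq0.

End C0.

Section Properties.
Variables (R : realType) (k : scalar_kind).
Local Notation K := (scalars R k).
Implicit Types (V : normedModType K).

Definition weakly_null V (x : nat -> V) : Prop :=
  forall f : dual V, f (x n) @[n --> \oo] --> (0 : K^o).

(* Only used for 1 <= r <= +oo. *)
Definition weakly_summable V (r : \bar R) (x : nat -> V) : Prop :=
  match r with
  | r'%:E => forall f : dual V, cvgn (series (fun n => rnorm (f (x n)) `^ r'))
  | +oo%E => weakly_null x
  | -oo%E => False
  end.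

Definition dunford_pettis_set V (A : set V) : Prop :=
  bounded_set A /\
  forall u : nat -> dual V, weakly_null u ->
    {uniform A, (fun n => u n : V -> K^o) @ \oo --> (cst 0 : V -> K^o)}.

Definition right_null V (r : \bar R) (x : nat -> V) : Prop :=
  weakly_summable r x /\ dunford_pettis_set (range x).

Definition DPrcP (r : \bar R) V : Prop :=
  forall x : nat -> V, right_null r x -> x n @[n --> \oo] --> (0 : V).

(* The supremum is over a bounded set of reals; for empty A it is 0. *)
Definition right_set V (r : \bar R) (A : set (dual V)) : Prop :=
  bounded_set A /\
  forall x : nat -> V, right_null r x ->
    sup [set rnorm (f (x n)) | f in A] @[n --> \oo] --> (0 : R).

Definition SR (r s : \bar R) V : Prop :=
  forall A : set (dual V), right_set r A -> right_set s A.

Definition isomorphic_embedding (V W : normedModType K) (T : {linear V -> W}) : Prop :=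
  continuous T /\
  exists2 c : K, 0 < c & forall x, c * `|x| <= `|T x|.

Definition contains_c0 V : Prop :=
  exists T : {linear c0 R k -> V}, isomorphic_embedding T.

End Properties.

(* Main.v *)
Require Import Defs.
From HB Require Import structures.
From mathcomp Require Import all_boot all_order all_algebra.
From mathcomp Require Import complex ring lra.
From mathcomp Require Import all_classical all_reals all_analysis.

(** Two facts about a sequence [x] whose series is weakly absolutely summable, that
    is weakly 1-summable, carry the equivalence.

    If [X] has the p-(DPrcP), then p-Right null sequences are norm null, so
    every bounded set of functionals is a p-Right set and (SR) is immediate.  A copy of
    [c0] is excluded because the images of the unit vectors are bounded
    away from zero and yet p-Right null ([DPrcP_no_c0]): they are weakly 1-summable,
    hence weakly p-summable, and they form a Dunford-Pettis set
    ([weakly_null_unif_small]).  For the latter, let [u] be weakly null in the dual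
    with large values [u m (x n)] for infinitely many [m].  By Rosenthal's lemma one
    can pass to subsequences along which the off-diagonal values are summable with
    small sum; then the functional sending [f] to the sum of the [f (x n)], [n] in the
    subsequence, stays away from zero along a subsequence of [u].

    Conversely, if [X] does not contain [c0], then every weakly 1-summable sequence
    is norm null ([bessaga_pelczynski]).  Otherwise some subsequence is bounded
    away from zero.  Uniform boundedness on the dual makes the map sending the unit
    vectors of [c0] to this subsequence bounded, and Rosenthal's lemma, applied
    to norming functionals of the terms, extracts a further subsequence on which
    the map is bounded below ([c0_embedding]).  Consequently the dual unit ball is a
    1-Right set, hence by (SR) a p-Right set.  By Hahn-Banach
    ([norming_functional]) its supremum at [x n] is the norm of [x n], so p-Right
    null sequences are norm null.

    Both real and complex scalars are treated at once: norms are read as real numbers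
    through [rnorm], and choices of signs are replaced by unimodular scalars. *)

Set Implicit Arguments.
Unset Strict Implicit.
Unset Printing Implicit Defensive.

Import Order.TTheory GRing.Theory Num.Theory.
Import numFieldNormedType.Exports.

Local Open Scope classical_set_scope.
Local Open Scope ring_scope.

(** * Norms and limits in terms of real numbers *)

Section RealNormToolkit.
Variables (R : realType) (k : scalar_kind).
Local Notation K := (scalars R k).
Implicit Types V : normedModType K.

Lemma ler_toR_rnorm (z : K) : toR z <= rnorm (z : K^o).
Proof.
rewrite /rnorm; case: k z => z /=; first exact: ler_norm.
have := normc_ge_Re z; rewrite lecE => /andP[_]; apply: le_trans.
exact: ler_norm.
Qed.

Lemma ltr_ofR (x y : R) : (ofR x < ofR y :> K) = (x < y).
Proof. by rewrite lt_def [in RHS]lt_def ler_ofR (can_eq (@ofRK R k)). Qed.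

Lemma ofR1 : ofR 1 = 1 :> K. Proof. by case: k. Qed.

Lemma ofRN (r : R) : ofR (- r) = - ofR r :> K.
Proof. by apply/eqP; rewrite -subr_eq0 opprK -ofRD addNr ofR0. Qed.

Lemma ofRK_gt0 (e : K) : 0 < e -> exists2 d : R, 0 < d & ofR d = e.
Proof.
move=> e0; exists (toR e); last by rewrite toRK ?ltW.
by rewrite -ltr_ofR toRK ?ltW// ofR0.
Qed.

Lemma rnorm_gt0 V (x : V) : x != 0 -> 0 < rnorm x.
Proof.
move=> x0; rewrite lt_def rnorm_ge0 andbT.
by apply: contra x0 => /eqP/rnorm_eq0 ->.
Qed.

Lemma rnorm1 : rnorm (1 : K^o) = 1.
Proof. by apply: (can_inj (@ofRK R k)); rewrite ofR_rnorm normr1; case: k. Qed.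

Lemma rnorm_ofR (r : R) : rnorm (ofR r : K^o) = `|r|.
Proof.
apply: (can_inj (@ofRK R k)); rewrite ofR_rnorm.
have [r0|/ltW r0] := leP 0 r.
  by rewrite !ger0_norm// -(ofR0 R k) ler_ofR.
by rewrite !ler0_norm ?ofRN// -(ofR0 R k) ler_ofR.
Qed.

(** Multiplying by a scalar of modulus one turns any scalar into its modulus:
    this replaces the choice of signs available in the real case. *)
Lemma unimodular_multiplier (z : K) :
  exists2 c : K, rnorm (c : K^o) = 1 & c * z = ofR (rnorm (z : K^o)).
Proof.
have [->|z0] := eqVneq z 0; first by exists 1; rewrite ?rnorm1// mulr0 rnorm0 ofR0.
exists (`|z| / z); last by rewrite divfK ?ofR_rnorm.
apply: (can_inj (@ofRK R k)); rewrite (@ofR_rnorm _ _ K^o) normrM normfV normr_id.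
by rewrite divff ?normr_eq0// ofR1.
Qed.

Lemma rnormZ_ofR V (r : R) (x : V) : rnorm (ofR r *: x) = `|r| * rnorm x.
Proof. by rewrite rnormZ rnorm_ofR. Qed.

Lemma rnormN V (x : V) : rnorm (- x) = rnorm x.
Proof. by rewrite /rnorm normrN. Qed.

Lemma ler_rnormB V (x y : V) : rnorm (x - y) <= rnorm x + rnorm y.
Proof. by rewrite -(rnormN y) ler_rnormD. Qed.

Lemma rnormBC V (x y : V) : rnorm (x - y) = rnorm (y - x).
Proof. by rewrite -rnormN opprB. Qed.

Lemma ler_rnorm_sum V I (r : seq I) (P : pred I) (F : I -> V) :
  rnorm (\sum_(i <- r | P i) F i) <= \sum_(i <- r | P i) rnorm (F i).
Proof.
elim/big_ind2: _ => [|x u y v xu yv|//]; first by rewrite rnorm0.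
exact: le_trans (ler_rnormD _ _) (lerD _ _).
Qed.

Lemma cvg_rnormP V (x : nat -> V) (l : V) :
  x n @[n --> \oo] --> l <->
  forall e : R, 0 < e -> exists N, forall n, (N <= n)%N -> rnorm (x n - l) < e.
Proof.
split=> [/cvgrPdistC_lt xl e e0|xl].
  have /xl[N _ xN] : 0 < ofR e :> K by rewrite -(ofR0 R k) ltr_ofR.
  by exists N => n /xN; rewrite -ofR_rnorm ltr_ofR.
apply/cvgrPdistC_lt => e /ofRK_gt0[d d0 <-].
have [N xN] := xl d d0.
by exists N => // n /= /xN; rewrite -[`|_|]ofR_rnorm ltr_ofR.
Qed.

Lemma cvg_rnorm0P V (x : nat -> V) :
  x n @[n --> \oo] --> (0 : V) <->
  forall e : R, 0 < e -> exists N, forall n, (N <= n)%N -> rnorm (x n) < e.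
Proof.
rewrite cvg_rnormP; split=> xl e /xl[N xN]; exists N => n /xN;
  by rewrite subr0.
Qed.

Lemma cvg_realP (x : nat -> R) (l : R) :
  x n @[n --> \oo] --> l <->
  forall e : R, 0 < e -> exists N, forall n, (N <= n)%N -> `|x n - l| < e.
Proof.
split=> [/cvgrPdistC_lt xl e /xl[N _ xN]|xl]; first by exists N.
by apply/cvgrPdistC_lt => e /xl[N xN]; exists N.
Qed.

Lemma rnorm_limit_le V (x : nat -> V) (l a : V) (D : R) :
  x n @[n --> \oo] --> l ->
  (exists N, forall n, (N <= n)%N -> rnorm (x n - a) <= D) -> rnorm (l - a) <= D.
Proof.
move=> /cvg_rnormP xl [N xD]; apply/ler_addgt0Pr => e /xl[M xM].
have := xM (maxn N M) (leq_maxr _ _); have := xD (maxn N M) (leq_maxl _ _).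
set y := x _ => yD yl.
have -> : l - a = (y - a) - (y - l) by rewrite opprB [RHS]addrC addrA subrK.
by apply: le_trans (ler_rnormB _ _) _; rewrite lerD// ltW.
Qed.

Lemma rnorm_limit_ge V (x : nat -> V) (l : V) (D : R) :
  x n @[n --> \oo] --> l ->
  (exists N, forall n, (N <= n)%N -> D <= rnorm (x n)) -> D <= rnorm l.
Proof.
move=> /cvg_rnormP xl [N xD]; apply/ler_addgt0Pr => e /xl[M xM].
have := xM (maxn N M) (leq_maxr _ _); have := xD (maxn N M) (leq_maxl _ _).
set y := x _ => yD yl; apply: le_trans yD _.
have -> : y = l + (y - l) by rewrite addrC subrK.
by apply: le_trans (ler_rnormD _ _) _; rewrite lerD2l ltW.
Qed.

Lemma bounded_set_rnormP V (A : set V) :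
  bounded_set A <-> exists2 M : R, 0 <= M & forall x, A x -> rnorm x <= M.
Proof.
split=> [/pinfty_ex_gt0[M M0 AM]|[M M0 AM]].
  exists (toR M) => [|x /AM]; first by rewrite -(ler_ofR k) ofR0 toRK ltW.
  by rewrite ler_rnorm_ofR toRK// ltW.
exists (ofR M); split; first by apply: ger0_real; rewrite -(ofR0 R k) ler_ofR.
by move=> r Mr x /AM; rewrite ler_rnorm_ofR => xM; apply: le_trans xM (ltW Mr).
Qed.

Definition rcauchy V (x : nat -> V) := forall e : R, 0 < e ->
  exists N, forall n m, (N <= n)%N -> (N <= m)%N -> rnorm (x n - x m) < e.

Lemma rcauchy_cvg (V : completeNormedModType K) (x : nat -> V) :
  rcauchy x -> exists l : V, x n @[n --> \oo] --> l.
Proof.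
move=> xc; suff : cvgn x by move=> /cvg_ex.
apply/cauchy_cvgP/cauchy_exP => e /ofRK_gt0[d d0 <-].
have [N xN] := xc d d0; exists (x N); exists N => // n /= Nn.
by rewrite -ball_normE /= -[`|_|]ofR_rnorm ltr_ofR; exact: xN.
Qed.

End RealNormToolkit.

Lemma rcauchy_cvg_real (R : realType) (x : nat -> R) :
  (forall e : R, 0 < e ->
    exists N, forall n m, (N <= n)%N -> (N <= m)%N -> `|x n - x m| < e) ->
  exists l : R, x n @[n --> \oo] --> l.
Proof. exact: (@rcauchy_cvg R RealScalars R). Qed.

Lemma rnormc (R : realType) (z : R[i]) :
  @rnorm R ComplexScalars (R[i]^o) z =
  Num.sqrt (complex.Re z ^+ 2 + complex.Im z ^+ 2).
Proof. by transitivity (complex.Re `|z|) => //; rewrite normc_def. Qed.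

(** Completeness of the scalar field; in the complex case it is checked on real
    and imaginary parts. *)
Lemma rcauchy_cvg_scalars (R : realType) (k : scalar_kind)
    (x : nat -> (scalars R k)^o) :
  rcauchy x -> exists l : (scalars R k)^o, x n @[n --> \oo] --> l.
Proof.
case: k x => x xc; first exact: rcauchy_cvg_real xc.
have abs_sqrt (a b : R) : `|a| <= Num.sqrt (a ^+ 2 + b ^+ 2).
  by rewrite -sqrtr_sqr ler_wsqrtr// lerDl sqr_ge0.
have [a xa] : exists l : R, complex.Re (x n) @[n --> \oo] --> l.
  apply: rcauchy_cvg_real => e /xc[N xN]; exists N => n m Nn Nm.
  apply: le_lt_trans (xN n m Nn Nm); rewrite rnormc.
  by case: (x n) (x m) => [u v] [u' v'] /=; exact: abs_sqrt.
have [b xb] : exists l : R, complex.Im (x n) @[n --> \oo] --> l.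
  apply: rcauchy_cvg_real => e /xc[N xN]; exists N => n m Nn Nm.
  apply: le_lt_trans (xN n m Nn Nm); rewrite rnormc.
  case: (x n) (x m) => [u v] [u' v'] /=.
  by rewrite [X in Num.sqrt X]addrC; exact: abs_sqrt.
exists (Complex a b); apply/(@cvg_rnormP R ComplexScalars) => e e0.
move/cvg_realP: xa => /(_ (e / 2)) []; first by rewrite divr_gt0.
move=> N xN; move/cvg_realP: xb => /(_ (e / 2)) []; first by rewrite divr_gt0.
move=> M xM; exists (maxn N M) => n; rewrite geq_max => /andP[/xN xa /xM xb].
rewrite rnormc; case: (x n) xa xb => u v /= ua vb.
have -> : e = Num.sqrt (e ^+ 2) by rewrite sqrtr_sqr gtr0_norm.
rewrite ltr_sqrt ?exprn_gt0//.
move: ua vb; rewrite !ltr_norml => /andP[? ?] /andP[? ?].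
nra.
Qed.

(** * Bounded functionals and the Hahn-Banach theorem *)

Section DualBounds.
Variables (R : realType) (k : scalar_kind) (V : normedModType (scalars R k)).
Local Notation K := (scalars R k).

Lemma rnorm_dualE (f : dual V) : rnorm f = supnorm (@unit_ball R k V) f.
Proof. exact: ofRK. Qed.

Lemma unit_ballE (x : V) : unit_ball x = (rnorm x <= 1) :> Prop.
Proof. by rewrite ler_rnorm_ofR ofR1. Qed.

Lemma continuous_linear_bound (W : normedModType K) (f : {linear V -> W}) :
  continuous f -> exists2 M : R, 0 <= M & forall x, rnorm (f x) <= M * rnorm x.
Proof.
move=> cf; have /linear_boundedP := continuous_linear_bounded 0 (cf 0).
move=> /pinfty_ex_gt0[M M0 fM]; exists (toR M) => [|x].
  by rewrite -(ler_ofR k) ofR0 toRK ltW.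
by rewrite ler_rnorm_ofR ofRM ofR_rnorm toRK ?(ltW M0).
Qed.

Lemma dual_bounded_on (f : dual V) : bounded_on (@unit_ball R k V) f.
Proof.
have [M M0 fM] := continuous_linear_bound (@dual_continuous R k V f).
exists M => x; rewrite unit_ballE => x1.
by apply: le_trans (fM x) _; rewrite ler_piMr.
Qed.

Lemma dual_bound (f : dual V) (x : V) : rnorm (f x) <= rnorm f * rnorm x.
Proof.
have [->|x0] := eqVneq x 0; first by rewrite linear0 !rnorm0 mulr0.
have nx0 := rnorm_gt0 x0.
have : rnorm (f (ofR (rnorm x)^-1 *: x)) <= rnorm f.
  rewrite rnorm_dualE; apply: supnorm_ub; first exact: dual_bounded_on.
  by rewrite unit_ballE rnormZ_ofR ger0_norm ?invr_ge0 ?rnorm_ge0// mulVf ?gt_eqF.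
rewrite linearZ rnormZ_ofR ger0_norm ?invr_ge0 ?rnorm_ge0//.
by rewrite ler_pdivrMl// mulrC.
Qed.

Lemma dual_norm_le (f : dual V) (C : R) : 0 <= C ->
  (forall x, rnorm (f x) <= C * rnorm x) -> rnorm f <= C.
Proof.
move=> C0 fC; rewrite rnorm_dualE; apply: supnorm_le.
  by exists 0; rewrite unit_ballE rnorm0.
by move=> x; rewrite unit_ballE => x1; apply: le_trans (fC x) _; rewrite ler_piMr.
Qed.

Lemma rnorm_bound_continuous (W : normedModType K) (f : {linear V -> W}) (C : R) :
  (forall x, rnorm (f x) <= C * rnorm x) -> continuous f.
Proof.
move=> fC; apply: bounded_linear_continuous; apply/linear_boundedP.
exists (ofR `|C|); split; first by apply: ger0_real; rewrite -(ofR0 R k) ler_ofR.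
move=> r Cr x; apply: (@le_trans _ _ (ofR `|C| * `|x|)); last first.
  by rewrite ler_wpM2r// ltW.
rewrite -(ofR_rnorm x) -ofRM -ler_rnorm_ofR; apply: le_trans (fC x) _.
by rewrite ler_wpM2r ?rnorm_ge0// ler_norm.
Qed.

Lemma bounded_linear_dual (f : V -> K^o) (C : R) : linear f -> 0 <= C ->
  (forall x, rnorm (f x) <= C * rnorm x) ->
  exists2 g : dual V, (forall x, g x = f x) & rnorm g <= C.
Proof.
move=> lf C0 fC.
pose h : {linear V -> K^o} := HB.pack f (GRing.isLinear.Build _ _ _ _ _ lf).
have ch : continuous h by exact: (@rnorm_bound_continuous K^o h C fC).
have fP : f \in @dual_pred R k V by apply/asboolP; split.
by exists (Dual fP) => //; exact: dual_norm_le.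
Qed.

End DualBounds.

Section HahnBanach.
Variables (R : realType) (k : scalar_kind) (V : normedModType (scalars R k)).
Local Notation K := (scalars R k).
Implicit Types A : set (V * R).

(** A real subspace of [V * R] below the norm: such a subspace contains no
    vertical line, hence is the graph of a partial real-linear functional. *)
Definition dominated_graph A :=
  [/\ forall v s w t, A (v, s) -> A (w, t) -> A (v + w, s + t),
      forall r v s, A (v, s) -> A (ofR r *: v, r * s) &
      forall v s, A (v, s) -> s <= rnorm v].

Lemma dominated_graph_fun A v s t : dominated_graph A ->
  A (v, s) -> A (v, t) -> s = t.
Proof.
have half s' t' : dominated_graph A -> A (v, s') -> A (v, t') -> s' <= t'.
  move=> [AD AZ An] As At; have := AD _ _ _ _ As (AZ (-1) _ _ At).
  by rewrite ofRN ofR1 scaleN1r mulN1r subrr => /An; rewrite rnorm0 subr_le0.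
by move=> dA As At; apply/eqP; rewrite eq_le !half.
Qed.

(** Below are the values available for one more vector [v]: subadditivity of the
    norm makes every lower bound smaller than every upper bound. *)
Lemma dominated_graph_gap A v : dominated_graph A -> A !=set0 ->
  exists r, forall w s, A (w, s) -> s - rnorm (w - v) <= r <= rnorm (w + v) - s.
Proof.
move=> [AD AZ An] [[w0 s0] A0].
pose B := [set q.2 - rnorm (q.1 - v) | q in A].
have le_gap w s w' s' : A (w, s) -> A (w', s') ->
    s - rnorm (w - v) <= rnorm (w' + v) - s'.
  move=> Aw Aw'; rewrite lerBlDr addrAC lerBrDr.
  apply: le_trans (An _ _ (AD _ _ _ _ Aw Aw')) _.
  have -> : w + w' = (w' + v) + (w - v) by rewrite addrC addrACA subrr addr0 addrC.
  exact: ler_rnormD.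
exists (sup B) => w s Aw; apply/andP; split.
  apply: ub_le_sup; last by exists (w, s).
  by exists (rnorm (w0 + v) - s0) => _ [[w' s'] Aw' <-]; exact: le_gap.
apply: ge_sup; first by exists (s0 - rnorm (w0 - v)), (w0, s0).
by move=> _ [[w' s'] Aw' <-]; exact: le_gap.
Qed.

(** Domination on the larger space only has to be checked for the multiples [v]
    and [- v] of the new vector, by homogeneity; there it is the choice of [r]. *)
Lemma dominated_graph_extend A v : dominated_graph A -> A !=set0 ->
  exists B, [/\ dominated_graph B, A `<=` B & exists r, B (v, r)].
Proof.
move=> dA A0; have [r rP] := dominated_graph_gap v dA A0.
have [AD AZ An] := dA.
have {A0} A00 : A (0, 0).
  by case: A0 => -[w s] /(AZ 0); rewrite ofR0 scale0r mul0r.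
exists [set q | exists w s t, A (w, s) /\ q = (w + ofR t *: v, s + t * r)]; split.
- split.
  + move=> _ _ _ _ [w [s [t [Aw [-> ->]]]]] [w' [s' [t' [Aw' [-> ->]]]]].
    exists (w + w'), (s + s'), (t + t'); split; first exact: AD.
    by rewrite ofRD scalerDl mulrDl addrACA [in X in (_, X)]addrACA.
  + move=> a _ _ [w [s [t [Aw [-> ->]]]]].
    exists (ofR a *: w), (a * s), (a * t); split; first exact: AZ.
    by rewrite scalerDr scalerA ofRM mulrDr mulrA.
  + move=> _ _ [w [s [t [Aw [-> ->]]]]].
    have [t0|t0|->] := ltgtP t 0; last first.
    * by rewrite ofR0 scale0r mul0r !addr0; exact: An.
    * have ti : 0 <= t^-1 by rewrite invr_ge0 ltW.
      have /andP[_] := rP _ _ (AZ t^-1 _ _ Aw).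
      rewrite lerBrDl -(ler_pM2l t0) mulrDr mulrA divff ?gt_eqF// mul1r.
      move=> /le_trans; apply; rewrite -{1}(ger0_norm (ltW t0)) -rnormZ_ofR.
      by rewrite scalerDr scalerA -ofRM divff ?gt_eqF// ofR1 scale1r.
    * have u0 : 0 < - t by rewrite oppr_gt0.
      have ui : 0 <= (- t)^-1 by rewrite invr_ge0 ltW.
      have /andP[+ _] := rP _ _ (AZ (- t)^-1 _ _ Aw).
      rewrite lerBlDr -lerBlDl -(ler_pM2l u0) mulrBr mulrA divff ?gt_eqF// mul1r.
      rewrite mulNr opprK => /le_trans; apply.
      rewrite -{1}(ger0_norm (ltW u0)) -rnormZ_ofR.
      rewrite scalerBr scalerA -ofRM divff ?gt_eqF// ofR1 scale1r.
      by rewrite ofRN scaleNr opprK.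
- by move=> [w s] Aw; exists w, s, 0; rewrite ofR0 scale0r mul0r !addr0.
- by exists r, 0, 0, 1; rewrite ofR1 scale1r mul1r !add0r.
Qed.

Lemma hahn_banach_real (x0 : V) : exists u : V -> R,
  [/\ forall x y, u (x + y) = u x + u y,
      forall r x, u (ofR r *: x) = r * u x,
      forall x, u x <= rnorm x & u x0 = rnorm x0].
Proof.
(* The empty graph has to be allowed, as the union of the empty chain. *)
pose P A := dominated_graph A /\ (A !=set0 -> A (x0, rnorm x0)).
have [A [[dA Ax0] Amax]] : exists A, P A /\ forall B, A `<` B -> ~ P B.
  apply: Zorn_bigcup => F FP Ftot; split.
    split.
    - move=> v s w t [X FX Xv] [Y FY Yw].
      have [/(_ _ Xv) Yv|/(_ _ Yw) Xw] := Ftot _ _ FX FY.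
        by exists Y => //; have [[YD _ _] _] := FP _ FY; exact: YD.
      by exists X => //; have [[XD _ _] _] := FP _ FX; exact: XD.
    - move=> r v s [X FX Xv].
      by exists X => //; have [[_ XZ _] _] := FP _ FX; exact: XZ.
    - by move=> v s [X FX Xv]; have [[_ _ Xn] _] := FP _ FX; exact: Xn.
  move=> [q [X FX Xq]]; exists X => //; have [_] := FP _ FX; apply.
  by exists q.
have {}Ax0 : A (x0, rnorm x0).
  apply: contrapT => nA; have A0 : A = set0.
    by apply/eqP/negPn/negP => /set0P /Ax0.
  pose G := [set q : V * R | exists t, q = (ofR t *: x0, t * rnorm x0)].
  have Gx0 : G (x0, rnorm x0) by exists 1; rewrite ofR1 scale1r mul1r.
  apply: (Amax G).
    by rewrite A0 properEneq; split => //; apply/eqP => /esym G0;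
      move: Gx0; rewrite G0.
  split=> //; split.
  - by move=> _ _ _ _ [s [-> ->]] [t [-> ->]]; exists (s + t);
      rewrite ofRD scalerDl mulrDl.
  - by move=> r _ _ [s [-> ->]]; exists (r * s); rewrite scalerA ofRM mulrA.
  - move=> _ _ [s [-> ->]]; rewrite rnormZ_ofR ler_wpM2r ?rnorm_ge0//.
    exact: ler_norm.
have Atot v : exists r, A (v, r).
  have A0 : A !=set0 by exists (x0, rnorm x0).
  have [B [dB AB [r Br]]] := dominated_graph_extend v dA A0.
  exists r; apply: contrapT => nA; apply: (Amax B).
    by split=> // /(_ _ Br).
  by split => // _; exact: AB.
have [u uP] := choice Atot; have [AD AZ An] := dA; exists u; split.
- by move=> x y; apply: (dominated_graph_fun dA (uP _)); exact: AD.
- by move=> r x; apply: (dominated_graph_fun dA (uP _)); exact: AZ.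
- by move=> x; exact: An (uP x).
- exact: (dominated_graph_fun dA (uP _)).
Qed.

Lemma complexification (u : V -> R) :
  (forall x y, u (x + y) = u x + u y) -> (forall r x, u (ofR r *: x) = r * u x) ->
  exists2 f : V -> K^o, linear f & forall x, toR (f x) = u x.
Proof.
case: k V u => W u uD uZ.
  by exists u => // a x y; rewrite uD uZ.
(* The imaginary part is forced: Im (f x) = - Re (i * f x) = - Re (f (i x)). *)
pose i : R[i] := Complex 0 1.
exists (fun x => Complex (u x) (- u (i *: x)) : R[i]) => // a x y.
have aE (z : R[i]) (w : W) : z *: w =
    @ofR R ComplexScalars (complex.Re z) *: w +
    @ofR R ComplexScalars (complex.Im z) *: (i *: w).
  rewrite scalerA -scalerDl; congr (_ *: _).
  case: z => b c; apply/eqP; rewrite eq_complex /=.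
  by apply/andP; split; apply/eqP; lra.
have ii w : u (i *: (i *: w)) = - u w.
  rewrite scalerA; have -> : i * i = @ofR R ComplexScalars (-1).
    by apply/eqP; rewrite eq_complex /=; apply/andP; split; apply/eqP; lra.
  by rewrite uZ mulN1r.
rewrite scalerDr uD [u (i *: _ + _)]uD.
rewrite scalerA (mulrC i) -scalerA ![u (a *: _)](congr1 u (aE _ _)) !uD !uZ ii.
case: a => b c; apply/eqP; rewrite eq_complex /=.
by apply/andP; split; apply/eqP; lra.
Qed.

(** Hahn-Banach for either scalar field.  The bound on the functional follows from
    that on its real part, since a unimodular multiple of the argument makes the
    value real. *)
Lemma norming_functional (x0 : V) :
  exists2 f : dual V, rnorm f <= 1 & rnorm (f x0) = rnorm x0.
Proof.
have [u [uD uZ un ux0]] := hahn_banach_real x0.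
have [f lf fu] := complexification uD uZ.
pose h : {linear V -> K^o} := HB.pack f (GRing.isLinear.Build _ _ _ _ _ lf).
have fn x : rnorm (f x) <= 1 * rnorm x.
  have [c c1 cf] := unimodular_multiplier (f x).
  have : f (c *: x) = c * f x by exact: (linearZ_LR h c x).
  rewrite cf mul1r => /(congr1 toR); rewrite ofRK fu => <-.
  by apply: le_trans (un _) _; rewrite rnormZ c1 mul1r.
have [g gf g1] := bounded_linear_dual lf ler01 fn.
exists g => //; apply/eqP; rewrite eq_le gf; apply/andP; split.
  by have := fn x0; rewrite mul1r.
by rewrite -{1}ux0 -fu; exact: ler_toR_rnorm.
Qed.

End HahnBanach.

(** * Nonnegative sums and Rosenthal's lemma *)

Section NonnegativeSums.
Variable R : realType.
Implicit Types (a b : nat -> R).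

Lemma sum_nat_ord (V : zmodType) (z : nat -> V) m n : (m <= n)%N ->
  \sum_(i < n) z i - \sum_(i < m) z i = \sum_(m <= i < n) z i.
Proof.
move=> mn; rewrite -!(big_mkord xpredT z) (@big_cat_nat _ _ _ m)//=.
by rewrite addrAC subrr add0r.
Qed.

Lemma ler_sum_uniq a (C : R) (s : seq nat) : (forall i, 0 <= a i) ->
  (forall N, \sum_(i < N) a i <= C) -> uniq s -> \sum_(i <- s) a i <= C.
Proof.
move=> a0 aC us; pose N := (\max_(i <- s) i).+1.
have -> : \sum_(i <- s) a i = \sum_(i <- iota 0 N | i \in s) a i.
  rewrite -[RHS]big_filter; apply: perm_big; apply: uniq_perm => //.
    by rewrite filter_uniq// iota_uniq.
  move=> i; rewrite mem_filter mem_iota add0n /= ltnS.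
  by case: (boolP (i \in s)) => //= si; rewrite (@leq_bigmax_seq _ s xpredT id).
apply: le_trans (aC N); rewrite -(big_mkord xpredT a) /index_iota subn0 big_mkcond.
by apply: ler_sum => i _; case: ifP.
Qed.

Lemma ler_sum_inj a (C : R) (t : nat -> nat) N : (forall i, 0 <= a i) ->
  (forall N, \sum_(i < N) a i <= C) -> injective t -> \sum_(i < N) a (t i) <= C.
Proof.
move=> a0 aC tI; rewrite -(big_mkord xpredT (a \o t)) -(big_map t xpredT a).
by apply: ler_sum_uniq; rewrite ?map_inj_uniq ?iota_uniq.
Qed.

Lemma ler_sum_term a (C : R) n : (forall i, 0 <= a i) ->
  (forall N, \sum_(i < N) a i <= C) -> a n <= C.
Proof.
by move=> a0 aC; have := @ler_sum_uniq a C [:: n] a0 aC; rewrite big_seq1; apply.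
Qed.

Lemma nonneg_series_tail a (C : R) : (forall i, 0 <= a i) ->
  (forall N, \sum_(i < N) a i <= C) -> forall e : R, 0 < e ->
  exists N, forall m n, (N <= m)%N -> \sum_(m <= i < n) a i < e.
Proof.
move=> a0 aC e e0; pose S := [set \sum_(i < n) a i | n in [set: nat]].
have supS : has_sup S.
  split; first by exists (\sum_(i < 0) a i), 0%N.
  by exists C => _ [n _ <-].
have [_ [N _ <-] Ne] := sup_adherent e0 supS.
exists N => m n Nm; have [mn|nm] := leqP n m; first by rewrite big_geq.
rewrite -sum_nat_ord ?(ltnW nm)//.
have : \sum_(i < n) a i <= sup S by apply: ub_le_sup; [case: supS | exists n].
have : \sum_(i < N) a i <= \sum_(i < m) a i.
  by rewrite -subr_ge0 sum_nat_ord// sumr_ge0.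
by move: Ne; lra.
Qed.

(** Rosenthal's lemma.  Split the indices into infinitely many infinite classes.
    If no class works, each class contains a row whose off-diagonal mass inside
    the class exceeds [e]; on the set of these rows the total mass of every row
    has dropped by [e], since different rows lie in different classes.  This
    can be repeated only finitely often. *)
Lemma rosenthal (a : nat -> nat -> R) (C e : R) : 0 < e ->
  (forall k i, 0 <= a k i) -> (forall k N, \sum_(i < N) a k i <= C) ->
  exists2 s : nat -> nat, injective s &
    forall k N, \sum_(i < N | i != k :> nat) a (s k) (s i) <= e.
Proof.
move=> e0; have [n Cn] : exists n : nat, C <= n%:R * e.
  exists (Num.truncn (C / e)).+1; rewrite -ler_pdivrMr//; exact/ltW/truncnS_gt.
elim: n a C Cn => [|n IH] a C Cn a0 aC.
  exists id => // k N; apply: (@le_trans _ _ C); last by rewrite mul0r in Cn; lra.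
  apply: le_trans (aC k N); rewrite big_mkcond; apply: ler_sum => i _.
  by case: ifP.
(* [t p j] is the [j]-th index of the [p]-th class. *)
pose t (p j : nat) : nat := pickle (p, j).
have tI p q i j : t p i = t q j -> p = q /\ i = j.
  by move=> /(pcan_inj pickleK)[-> ->].
have [[p pe]|] := pselect
    (exists p, forall k N, \sum_(i < N | i != k :> nat) a (t p k) (t p i) <= e).
  by exists (t p) => // i j /tI[].
move=> /forallNP/(_ _)/existsNP nt.
have /choice[kN kNP] : forall p, exists q : nat * nat,
    e < \sum_(i < q.2 | i != q.1 :> nat) a (t p q.1) (t p i).
  move=> p; have [k /existsNP[N /negP]] := nt p; rewrite -ltNge.
  by exists (k, N).
(* The representative rows, one per class. *)
pose m p := t p (kN p).1.
have mI : injective m by move=> p q /tI[].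
have [|||s sI se] := IH (fun p q => a (m p) (m q)) (C - e).
- by move: Cn; rewrite -natr1 mulrDl mul1r; lra.
- by move=> p q; exact: a0.
- move=> p N; rewrite lerBrDr.
  have := @ler_sum_uniq (a (m p)) C
    (map m (iota 0 N) ++ map (t p) [seq i <- iota 0 (kN p).2 | i != (kN p).1]).
  rewrite big_cat !big_map /= big_filter.
  rewrite -[in X in X + _](subn0 N) -[in X in _ + X](subn0 (kN p).2).
  rewrite -/(index_iota _ _) -/(index_iota _ _) !big_mkord => /(_ (a0 _) (aC _)) sC.
  apply: le_trans (sC _); first by rewrite lerD2l ltW// kNP.
  rewrite cat_uniq !map_inj_uniq ?iota_uniq ?filter_uniq ?iota_uniq ?andbT//=;
    last by move=> i j /tI[].
  apply/hasPn => _ /mapP[i + ->]; rewrite mem_filter => /andP[ik _].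
  by apply/mapP => -[q _ /tI[<- /eqP]]; rewrite (negPf ik).
exists (m \o s) => [|k N]; first exact: inj_comp.
exact: se.
Qed.

End NonnegativeSums.

(** * Series of functionals and uniform boundedness on the dual *)

Section DualSeries.
Variables (R : realType) (k : scalar_kind).
Local Notation K := (scalars R k).
Implicit Types V W : normedModType K.

Lemma series_rcauchy V (z : nat -> V) :
  (forall e : R, 0 < e ->
    exists N, forall m n, (N <= m)%N -> rnorm (\sum_(m <= i < n) z i) < e) ->
  rcauchy (fun n => \sum_(i < n) z i).
Proof.
move=> zP e /zP[N Ne]; exists N => n m.
wlog mn : n m / (m <= n)%N => [wl Nn Nm|Nn Nm].
  by have [/wl|/ltnW/wl] := leqP m n; [apply|rewrite rnormBC; apply].
by rewrite sum_nat_ord// Ne.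
Qed.

Lemma abs_summable_rcauchy V (z : nat -> V) (C : R) :
  (forall N, \sum_(i < N) rnorm (z i) <= C) -> rcauchy (fun n => \sum_(i < n) z i).
Proof.
move=> zC; apply: series_rcauchy => e e0.
have [N Ne] := nonneg_series_tail (fun i => rnorm_ge0 (z i)) zC e0.
by exists N => m n Nm; rewrite (le_lt_trans (ler_rnorm_sum _ _ _))// Ne.
Qed.

Lemma pointwise_limit_linear V W (S : nat -> V -> W) (f : V -> W) :
  (forall n, linear (S n)) -> (forall v, S n v @[n --> \oo] --> f v) -> linear f.
Proof.
move=> lS Sf c v w; apply: (@norm_cvg_unique _ W _ _ _ _ (Sf _)).
rewrite /mkset (funext (fun n => lS n c v w) : (fun n => S n _) = _).
by apply: cvgD (Sf w); apply: cvgZl_tmp; exact: Sf.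
Qed.

(** A pointwise absolutely convergent series of functionals need not converge in
    norm, but its sum is bounded as soon as the sums of moduli are bounded on
    the unit ball. *)
Lemma dual_series V (phi : nat -> dual V) (C : R) : 0 <= C ->
  (forall v N, \sum_(n < N) rnorm (phi n v) <= C * rnorm v) ->
  exists psi : dual V, forall v, \sum_(n < N) phi n v @[N --> \oo] --> psi v.
Proof.
move=> C0 phiC.
have /choice[f fP] : forall v, exists l : K^o,
    \sum_(n < N) phi n v @[N --> \oo] --> l.
  move=> v; apply: rcauchy_cvg_scalars.
  exact: (@abs_summable_rcauchy K^o (fun n => phi n v) _ (phiC v)).
have lf : linear f.
  by apply: pointwise_limit_linear fP => n c v w; rewrite scaler_sumr -big_split;
    apply: eq_bigr => i _; rewrite linearP.
have [|psi psif _] := bounded_linear_dual lf C0; last first.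
  by exists psi => v; rewrite psif.
move=> v; rewrite -[f v]subr0; apply: rnorm_limit_le (fP v) _; exists 0%N => n _.
by rewrite subr0; apply: le_trans (phiC v n); exact: ler_rnorm_sum.
Qed.

(** The dual of a normed space is a Banach space, so the uniform boundedness
    principle holds for the seminorms [p n] on it.  If they were unbounded on the
    unit ball, one could sum functionals [h j] of quickly decreasing norm such that
    for a suitable [m j] the value of [p (m j)] at [h j] exceeds by [j] its values
    at the sum of all earlier terms, while it is at most one on the sum of
    all later terms. *)
Lemma dual_uniform_boundedness V (p : nat -> dual V -> R) (S : nat -> R) :
  (forall n f g, p n (f + g) <= p n f + p n g) ->
  (forall n (c : K) f, p n (c *: f) = rnorm (c : K^o) * p n f) ->
  (forall n f, p n f <= S n * rnorm f) ->
  (forall f, exists B, forall n, p n f <= B) ->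
  exists2 C : R, 0 <= C & forall n f, p n f <= C * rnorm f.
Proof.
move=> pD pZ pS /choice[B BP]; apply: contrapT => nC.
have pN n f : p n (- f) = p n f.
  by rewrite -scaleN1r pZ -ofR1 -ofRN rnorm_ofR normrN normr1 mul1r.
have p0 n : p n 0 = 0 by rewrite -(scale0r 0) pZ rnorm0 mul0r.
have large (eta L : R) : 0 < eta ->
    exists hm : dual V * nat, rnorm hm.1 <= eta /\ L <= p hm.2 hm.1.
  move=> eta0; apply: contrapT => nh; apply: nC.
  exists (`|L| / eta); first by rewrite divr_ge0// ltW.
  move=> n f; rewrite leNgt; apply/negP => fn; apply: nh.
  have f0 : f != 0.
    by apply: contraTneq fn => ->; rewrite rnorm0 mulr0 -leNgt p0.
  have nf0 := rnorm_gt0 f0.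
  have c0 : 0 <= eta / rnorm f by apply: divr_ge0; apply: ltW.
  exists (ofR (eta / rnorm f) *: f, n) => /=.
  rewrite rnormZ_ofR pZ rnorm_ofR ger0_norm// divfK ?gt_eqF//; split=> //.
  apply: le_trans (ler_norm L) _.
  have -> : `|L| = eta / rnorm f * (`|L| / eta * rnorm f).
    by field; rewrite !gt_eqF.
  by rewrite ler_wpM2l// ltW.
have /choice[pick pickP] : forall q : nat * (dual V * R), exists hm : dual V * nat,
    0 < q.2.2 -> rnorm hm.1 <= q.2.2 / 2 /\ q.1%:R + B q.2.1 <= p hm.2 hm.1.
  move=> [j [F eta]] /=; have [eta0|eta0] := ltP 0 eta; last by exists (0, 0%N).
  by have [|hm hmP] := large (eta / 2) (j%:R + B F); [rewrite divr_gt0|exists hm].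
(* The state is the sum of the functionals chosen so far, with a bound on the
   norm of everything that may still be added to it. *)
pose next j (s : dual V * R) := let hm := pick (j, s) in
  (s.1 + hm.1, Num.min (s.2 / 2) (1 + `|S hm.2|)^-1).
pose st := nat_rect (fun _ => dual V * R)%type (0, 1) next.
pose h j := (pick (j, st j)).1; pose m j := (pick (j, st j)).2.
pose F j := (st j).1; pose eta j := (st j).2.
have FS j : F j.+1 = F j + h j by [].
have etaS j : eta j.+1 = Num.min (eta j / 2) (1 + `|S (m j)|)^-1 by [].
have S1 j : 0 < 1 + `|S (m j)| by have := normr_ge0 (S (m j)); lra.
have eta0 j : 0 < eta j.
  by elim: j => [|j IH]; rewrite ?ltr01// etaS lt_min divr_gt0// invr_gt0 S1.
have hP j : rnorm (h j) <= eta j / 2 /\ j%:R + B (F j) <= p (m j) (h j).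
  exact: (pickP (j, st j) (eta0 j)).
have FE j v : F j v = \sum_(i < j) h i v.
  by elim: j => [|j IH]; rewrite ?big_ord0// big_ord_recr -IH FS.
have tail d j : \sum_(j <= i < j + d) rnorm (h i) <= eta j.
  elim: d j => [|d IH] j; first by rewrite addn0 big_geq// ltW.
  rewrite big_ltn ?addnS ?ltnS ?leq_addr// -addSn.
  have := IH j.+1; have [hj _] := hP j.
  have : eta j.+1 <= eta j / 2 by rewrite etaS ge_min lexx.
  by move: hj; lra.
have [||psi psiP] := @dual_series V h 1; first by [].
  move=> v N; apply: (@le_trans _ _ (\sum_(n < N) rnorm (h n) * rnorm v)).
    by apply: ler_sum => i _; exact: dual_bound.
  rewrite -mulr_suml ler_wpM2r ?rnorm_ge0//.
  by have := tail N 0%N; rewrite big_mkord.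
have psiF j : rnorm (psi - F j) <= eta j.
  apply: dual_norm_le => [|v]; first exact: ltW.
  have -> : (psi - F j) v = psi v - F j v by [].
  apply: rnorm_limit_le (psiP v) _; exists j => n jn.
  rewrite FE (sum_nat_ord (fun i => h i v))//.
  apply: le_trans (ler_rnorm_sum _ _ _) _.
  apply: (@le_trans _ _ (\sum_(j <= i < n) rnorm (h i) * rnorm v)).
    by apply: ler_sum => i _; exact: dual_bound.
  rewrite -mulr_suml ler_wpM2r ?rnorm_ge0//.
  by have := tail (n - j)%N j; rewrite subnKC.
have Bj j : j%:R - 1 <= B psi.
  have [_ hj] := hP j; have Fj := BP (F j) (m j); have psij := BP psi (m j).
  have rest : p (m j) (psi - F j.+1) <= 1.
    apply: le_trans (pS _ _) _.
    apply: (@le_trans _ _ (`|S (m j)| * (1 + `|S (m j)|)^-1)).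
      apply: le_trans (ler_wpM2r (rnorm_ge0 _) (ler_norm _)) _.
      rewrite ler_wpM2l//; apply: le_trans (psiF _) _.
      by rewrite etaS ge_min lexx orbT.
    by rewrite ler_pdivrMr// mul1r lerDr.
  have : p (m j) (h j) <=
      p (m j) psi + p (m j) (psi - F j.+1) + p (m j) (F j).
    have -> : h j = psi - (psi - F j.+1) - F j.
      by rewrite FS opprB addrCA subrr addr0 addrAC subrr add0r.
    by do 2 (apply: le_trans (pD _ _ _) _; rewrite pN lerD2r).
  by move: hj Fj rest psij; lra.
have := Bj (Num.truncn (`|B psi| + 1)).+1.
have := truncnS_gt (`|B psi| + 1); have := ler_norm (B psi); lra.
Qed.

(** Partial sums of moduli are seminorms on the dual, so a pointwise bound on them
    is uniform. *)
Lemma weakly_summable_unif_bound V (x : nat -> V) :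
  (forall f : dual V, exists B, forall N, \sum_(i < N) rnorm (f (x i)) <= B) ->
  exists2 C : R, 0 <= C &
    forall (f : dual V) N, \sum_(i < N) rnorm (f (x i)) <= C * rnorm f.
Proof.
move=> xB.
have [|||//|C C0 xC] := @dual_uniform_boundedness V
    (fun N f => \sum_(i < N) rnorm (f (x i))) (fun N => \sum_(i < N) rnorm (x i)).
- by move=> n f g; rewrite -big_split; apply: ler_sum => i _;
  exact: (ler_rnormD (f (x i)) (g (x i))).
- by move=> n c f; rewrite mulr_sumr; apply: eq_bigr => i _;
  exact: (rnormZ c (f (x i))).
- move=> n f; rewrite mulr_suml; apply: ler_sum => i _.
  by rewrite mulrC; exact: dual_bound.
by exists C.
Qed.

Lemma weakly_bounded_bounded V (x : nat -> V) :
  (forall f : dual V, exists B, forall n, rnorm (f (x n)) <= B) ->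
  exists2 C : R, 0 <= C & forall n, rnorm (x n) <= C.
Proof.
move=> xB.
have [|||//|C C0 xC] := @dual_uniform_boundedness V
    (fun n f => rnorm (f (x n))) (fun n => rnorm (x n)).
- by move=> n f g; exact: (ler_rnormD (f (x n)) (g (x n))).
- by move=> n c f; exact: (rnormZ c (f (x n))).
- by move=> n f; rewrite mulrC; exact: dual_bound.
exists C => // n; have [f f1 <-] := norming_functional (x n).
by apply: le_trans (xC n f) _; rewrite ler_piMr.
Qed.

End DualSeries.

(** * Weakly summable sequences and copies of c0 *)

(** Relations are used so that both coordinates can be made injective along the
    same sequence. *)
Lemma infinitely_often_injection (P : nat -> nat -> Prop) :
  (forall N, exists m n, [/\ (N <= m)%N, (N <= n)%N & P m n]) ->
  exists s t : nat -> nat, [/\ injective s, injective t & forall j, P (s j) (t j)].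
Proof.
move=> ioP; have /choice[g gP] : forall N, exists q : nat * nat,
    [/\ (N <= q.1)%N, (N <= q.2)%N & P q.1 q.2].
  by move=> N; have [m [n mnP]] := ioP N; exists (m, n).
pose N := nat_rect (fun=> nat) 0%N (fun _ N => (maxn (g N).1 (g N).2).+1).
have inc_inj (t : nat -> nat) : (forall j, (t j < t j.+1)%N) -> injective t.
  move=> tS; have tlt : {homo t : m n / (m < n)%N}.
    by apply: homo_ltn => //; exact: ltn_trans.
  by move=> m n tmn; have [/tlt|/tlt|//] := ltngtP m n; rewrite tmn ltnn.
exists (fun j => (g (N j)).1), (fun j => (g (N j)).2); split=> [||j].
- apply: inc_inj => j; have [+ _ _] := gP (N j.+1).
  by apply: leq_trans; rewrite /= ltnS leq_maxl.
- apply: inc_inj => j; have [_ + _] := gP (N j.+1).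
  by apply: leq_trans; rewrite /= ltnS leq_maxr.
- by have [] := gP (N j).
Qed.

Lemma injection_unbounded (s : nat -> nat) N : injective s ->
  exists j, (N <= s j)%N.
Proof.
move=> sI; apply: contrapT => /forallNP sN.
have : (size (map s (iota 0 N.+1)) <= size (iota 0 N))%N.
  apply: uniq_leq_size; first by rewrite map_inj_uniq// iota_uniq.
  by move=> _ /mapP[j _ ->]; rewrite mem_iota /= add0n ltnNge; apply/negP/sN.
by rewrite size_map !size_iota ltnn.
Qed.

Section BessagaPelczynski.
Variables (R : realType) (k : scalar_kind).
Local Notation K := (scalars R k).

Lemma c0_cvg (z : c0 R k) : z n @[n --> \oo] --> (0 : K^o).
Proof. by case: z => z /= /asboolP. Qed.

Lemma c0_bounded_on (z : c0 R k) : bounded_on setT z.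
Proof.
have /cvg_seq_bounded : cvgn z by apply/cvg_ex; exists 0; exact: c0_cvg.
move=> /pinfty_ex_gt0[M M0 zM]; exists (toR M) => n _.
by rewrite ler_rnorm_ofR toRK ?(ltW M0)//; exact: zM.
Qed.

Lemma rnorm_c0E (z : c0 R k) : rnorm z = supnorm setT z.
Proof. exact: ofRK. Qed.

Lemma c0_coord_le (z : c0 R k) i : rnorm (z i) <= rnorm z.
Proof. by rewrite rnorm_c0E; apply: supnorm_ub => //; exact: c0_bounded_on. Qed.

Lemma c0_norm_le (z : c0 R k) (r : R) : (forall i, rnorm (z i) <= r) -> rnorm z <= r.
Proof.
by move=> zr; rewrite rnorm_c0E; apply: supnorm_le => //; exists 0%N.
Qed.

Variable X : completeNormedModType K.
Implicit Types w : nat -> X.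

(** Tested on a norming functional, a block of the series is a sum of moduli weighted
    by coefficients; the series thus converges for coefficients in [c0]. *)
Lemma unif_summable_block w (C : R) :
  (forall (f : dual X) N, \sum_(i < N) rnorm (f (w i)) <= C * rnorm f) ->
  forall (z : nat -> K^o) (e : R) m n, 0 <= C -> 0 <= e ->
  (forall i, (m <= i)%N -> rnorm (z i) <= e) ->
  rnorm (\sum_(m <= i < n) (z i : K) *: w i) <= C * e.
Proof.
move=> wC z e m n C0 e0 ze.
have [f f1 <-] := norming_functional (\sum_(m <= i < n) (z i : K) *: w i).
rewrite linear_sum; apply: le_trans (ler_rnorm_sum _ _ _) _.
apply: (@le_trans _ _ (\sum_(m <= i < n) e * rnorm (f (w i)))).
  rewrite big_nat_cond [leRHS]big_nat_cond; apply: ler_sum => i /andP[/andP[mi _] _].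
  by rewrite linearZ rnormZ ler_wpM2r ?rnorm_ge0// ze.
rewrite -mulr_sumr mulrC ler_wpM2r//.
apply: (@le_trans _ _ (\sum_(i < n) rnorm (f (w i)))).
  have [mn|nm] := leqP m n; last first.
    by rewrite big_geq ?(ltnW nm)// sumr_ge0// => i _; exact: rnorm_ge0.
  rewrite -(sum_nat_ord (fun i => rnorm (f (w i))) mn) gerBl.
  by apply: sumr_ge0 => i _; exact: rnorm_ge0.
by apply: le_trans (wC f n) _; rewrite ler_piMr.
Qed.

(** The operator sending the unit vectors of [c0] to the sequence [w] is bounded by
    weak summability; functionals almost biorthogonal to [w] make it bounded
    below. *)
Lemma c0_embedding w (g : nat -> dual X) (C d : R) : 0 <= C -> 0 < d ->
  (forall (f : dual X) N, \sum_(i < N) rnorm (f (w i)) <= C * rnorm f) ->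
  (forall j, rnorm (g j) <= 1) -> (forall j, d <= rnorm (g j (w j))) ->
  (forall j N, \sum_(i < N | i != j :> nat) rnorm (g j (w i)) <= d / 2) ->
  contains_c0 X.
Proof.
move=> C0 d0 wC g1 gd goff.
pose S N (z : c0 R k) := \sum_(i < N) (z i : K) *: w i.
have /choice[T TP] : forall z : c0 R k, exists l : X, S N z @[N --> \oo] --> l.
  move=> z; apply: rcauchy_cvg.
  apply: (@series_rcauchy _ _ _ (fun i => (z i : K) *: w i)) => e e0.
  have C1 : 0 < C + 1 by lra.
  have [N zN] := (cvg_rnorm0P _).1 (c0_cvg z) (e / (C + 1)) (divr_gt0 e0 C1).
  exists N => m n Nm; apply: (@le_lt_trans _ _ (C * (e / (C + 1)))).
    apply: (unif_summable_block wC) => //; first by apply: divr_ge0; exact: ltW.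
    by move=> i mi; apply/ltW/zN/(leq_trans Nm).
  by rewrite mulrA ltr_pdivrMr// mulrC ltr_pM2l//; lra.
have lT : linear T.
  apply: pointwise_limit_linear TP => n c v z; rewrite scaler_sumr -big_split.
  apply: eq_bigr => i _.
  have -> : (c *: v + z) i = c * v i + z i by [].
  by rewrite [LHS]scalerDl -scalerA.
pose h : {linear c0 R k -> X} := HB.pack T (GRing.isLinear.Build _ _ _ _ _ lT).
exists h; split.
  apply: (@rnorm_bound_continuous _ _ _ _ _ C) => z.
  rewrite -[h z]subr0; apply: rnorm_limit_le (TP z) _; exists 0%N => n _.
  rewrite subr0 /S -(big_mkord xpredT (fun i => (z i : K) *: w i)).
  apply: (unif_summable_block wC) => //; first exact: rnorm_ge0.
  by move=> i _; exact: c0_coord_le.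
exists (ofR (d / 2)); first by rewrite -(ofR0 R k) ltr_ofR divr_gt0.
move=> z; rewrite -!ofR_rnorm -ofRM ler_ofR.
suff : rnorm z <= (rnorm (T z) + d / 2 * rnorm z) / d.
  by rewrite ler_pdivlMr//; set a := rnorm z; set b := rnorm _; lra.
apply: c0_norm_le => j; rewrite ler_pdivlMr// -lerBlDr.
apply: rnorm_limit_ge (TP z) _; exists j.+1 => n jn.
have := dual_bound (g j) (S n z).
move=> /le_trans/(_ (ler_wpM2r (rnorm_ge0 _) (g1 j))); rewrite mul1r; apply: le_trans.
rewrite /S linear_sum (bigD1 (Ordinal jn))//= lerBlDr.
pose off := \sum_(i < n | i != Ordinal jn) g j ((z i : K) *: w i).
have offle : rnorm off <= d / 2 * rnorm z.
  apply: le_trans (ler_rnorm_sum _ _ _) _.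
  apply: le_trans (ler_wpM2r (rnorm_ge0 z) (goff j n)).
  rewrite mulr_suml; apply: ler_sum => i _.
  by rewrite linearZ rnormZ mulrC ler_wpM2l ?rnorm_ge0// c0_coord_le.
have main : rnorm (z j) * d <= rnorm (g j ((z j : K) *: w j)).
  by rewrite linearZ rnormZ ler_wpM2l ?rnorm_ge0 ?gd.
apply: le_trans main _; apply: le_trans (lerD (lexx _) offle).
by rewrite -[X in rnorm X <= _](addrK off) ler_rnormB.
Qed.

(** Bessaga and Pelczynski.  Along a subsequence bounded away from zero, take norming
    functionals; Rosenthal's lemma, applied to their values on the terms, extracts
    a further subsequence to which these functionals are almost biorthogonal. *)
Theorem bessaga_pelczynski (x : nat -> X) : ~ contains_c0 X ->
  (forall f : dual X, exists B, forall N, \sum_(i < N) rnorm (f (x i)) <= B) ->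
  x n @[n --> \oo] --> (0 : X).
Proof.
move=> nc0 xB; have [C C0 xC] := weakly_summable_unif_bound xB.
apply: contrapT => nx; apply: nc0.
have [d d0 /infinitely_often_injection[_ [t [_ tI xt]]]] : exists2 d : R, 0 < d &
    forall N, exists m n, [/\ (N <= m)%N, (N <= n)%N & d <= rnorm (x n)].
  apply: contrapT => nd; apply: nx; apply/cvg_rnorm0P => e e0.
  apply: contrapT => /forallNP nN; apply: nd; exists e => // N.
  have /existsNP[n /not_implyP[Nn /negP]] := nN N.
  by rewrite -leNgt; exists n, n.
have /choice[f fP] : forall n, exists f : dual X,
    rnorm f <= 1 /\ rnorm (f (x (t n))) = rnorm (x (t n)).
  by move=> n; have [f] := norming_functional (x (t n)); exists f.
have sub (s : nat -> nat) (u : dual X) N : injective s ->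
    \sum_(i < N) rnorm (u (x (s i))) <= C * rnorm u.
  exact: (ler_sum_inj _ (fun i => rnorm_ge0 (u (x i))) (xC u)).
have d2 : 0 < d / 2 by rewrite divr_gt0.
have [||s sI sd] := @rosenthal R (fun j i => rnorm (f j (x (t i)))) C _ d2.
- by move=> j i; exact: rnorm_ge0.
- move=> j N; apply: le_trans (sub t (f j) N tI) _.
  by rewrite ler_piMr// (fP j).1.
apply: (@c0_embedding (x \o t \o s) (f \o s) C d) => //=.
- by move=> u N; apply: (sub (t \o s)); exact: inj_comp.
- by move=> j; exact: (fP _).1.
- by move=> j; rewrite (fP _).2.
Qed.

End BessagaPelczynski.

(** * The unit vectors of c0 *)

Section UnitVectors.
Variables (R : realType) (k : scalar_kind).
Local Notation K := (scalars R k).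

Lemma finite_support_c0 (c : nat -> K^o) N : exists z : c0 R k,
  forall i, z i = if (i < N)%N then c i else 0.
Proof.
pose u i : K^o := if (i < N)%N then c i else 0.
suff uP : u \in @c0_pred R k by exists (C0 uP).
apply/asboolP/cvg_rnorm0P => e e0; exists N => i; rewrite leqNgt /u.
by move=> /negPf ->; rewrite rnorm0.
Qed.

Lemma unit_vectors : exists e : nat -> c0 R k, forall n i, e n i = (i == n)%:R.
Proof.
have /choice[e eP] : forall n, exists z : c0 R k, forall i, z i = (i == n)%:R.
  move=> n; have [z zP] := finite_support_c0 (fun i => (i == n)%:R : K^o) n.+1.
  exists z => i; rewrite zP ltnS; case: leqP => // ni.
  by rewrite gtn_eqF.
by exists e.
Qed.

Lemma unit_vectors_comb (e : nat -> c0 R k) (c : nat -> K) N i :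
  (forall n i, e n i = (i == n)%:R) ->
  (\sum_(n < N) c n *: e n : c0 R k) i = if (i < N)%N then c i else 0.
Proof.
move=> eP; elim: N => [|N IH]; first by rewrite big_ord0.
have addE (a b : c0 R k) : (a + b : c0 R k) i = a i + b i by [].
have scaleE (b : K) (a : c0 R k) : (b *: a : c0 R k) i = b * a i by [].
rewrite big_ord_recr addE scaleE IH eP ltnS [(i <= N)%N]leq_eqVlt.
by case: (ltngtP i N) => [||->] /=; rewrite ?mulr0 ?addr0 ?mulr1 ?add0r.
Qed.

(** For operators out of [c0], unimodular multipliers turn the sum of moduli into
    the value at a single vector of norm at most one. *)
Lemma c0_image_weakly_summable (X : normedModType K)
    (T : {linear c0 R k -> X}) (M : R) (e : nat -> c0 R k) :
  (forall n i, e n i = (i == n)%:R) ->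
  0 <= M -> (forall z, rnorm (T z) <= M * rnorm z) ->
  forall (f : dual X) N, \sum_(i < N) rnorm (f (T (e i))) <= M * rnorm f.
Proof.
move=> eP M0 TM f N.
have /choice[c cP] : forall i, exists c : K, rnorm (c : K^o) = 1 /\
    c * f (T (e i)) = ofR (rnorm (f (T (e i)))).
  by move=> i; have [c] := unimodular_multiplier (f (T (e i))); exists c.
pose z := \sum_(i < N) c i *: e i.
have z1 : rnorm z <= 1.
  apply: c0_norm_le => i; rewrite (unit_vectors_comb c N i eP).
  by case: ifP => _; rewrite ?rnorm0// (cP i).1.
have fz : f (T z) = ofR (\sum_(i < N) rnorm (f (T (e i)))).
  rewrite /z linear_sum linear_sum; elim/big_rec2: _ => [|i a b _ ->].
    by rewrite ofR0.
  by rewrite ofRD -(cP i).2 !linearZ.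
have : rnorm (f (T z)) <= rnorm f * (M * 1).
  apply: le_trans (dual_bound f _) _; rewrite ler_wpM2l ?rnorm_ge0//.
  by apply: le_trans (TM z) _; rewrite ler_wpM2l.
rewrite fz rnorm_ofR mulr1 mulrC; apply: le_trans; exact: ler_norm.
Qed.

End UnitVectors.

Section UniformlySummable.
Variables (R : realType) (k : scalar_kind) (X : normedModType (scalars R k)).
Local Notation K := (scalars R k).
Variables (x : nat -> X) (M : R).
Hypothesis M0 : 0 <= M.
Hypothesis xM : forall (f : dual X) N, \sum_(i < N) rnorm (f (x i)) <= M * rnorm f.

Lemma unif_summable_weakly_summable (p : \bar R) : (1 < p)%E -> weakly_summable p x.
Proof.
have xle (f : dual X) n : rnorm (f (x n)) <= M * rnorm f.
  exact: (ler_sum_term n (fun i => rnorm_ge0 (f (x i))) (xM f)).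
case: p => [r| |]//; last first.
  move=> _ f; apply/cvg_rnorm0P => e e0.
  have [N Ne] := nonneg_series_tail (fun i => rnorm_ge0 (f (x i))) (xM f) e0.
  by exists N => n Nn; have := Ne n n.+1 Nn; rewrite big_nat1.
rewrite lte_fin => r1 f; set B := M * rnorm f.
apply: nondecreasing_is_cvgn.
  by apply: nondecreasing_series => n _ _; exact: powR_ge0.
(* With [a <= B], one has [a ^ r <= a * B ^ (r - 1)]. *)
exists (B * B `^ (r - 1)) => _ [n _ <-]; rewrite /series /= big_mkord.
apply: (@le_trans _ _ (\sum_(i < n) rnorm (f (x i)) * B `^ (r - 1))).
  apply: ler_sum => i _; have [->|a0] := eqVneq (rnorm (f (x i))) 0.
    by rewrite powR0 ?mul0r// gt_eqF//; lra.
  have -> : rnorm (f (x i)) `^ r = rnorm (f (x i)) * rnorm (f (x i)) `^ (r - 1).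
    rewrite -{2}(powRr1 (rnorm_ge0 (f (x i)))) -powRD ?a0 ?implybT//.
    by congr (_ `^ _); lra.
  rewrite ler_wpM2l ?rnorm_ge0//.
  apply: ge0_ler_powR; rewrite ?nnegrE ?rnorm_ge0 ?xle//.
    by lra.
  by rewrite mulr_ge0// rnorm_ge0.
by rewrite -mulr_suml ler_wpM2r ?powR_ge0//; exact: xM.
Qed.

Lemma evaluation (v : X) : exists phi : dual (dual X), forall f, phi f = f v.
Proof.
have [] := @bounded_linear_dual R k (dual X) (fun f => f v) (rnorm v).
- by move=> c f g.
- exact: rnorm_ge0.
- by move=> f; rewrite mulrC; exact: dual_bound.
- by move=> phi; exists phi.
Qed.

(** Summing along a set of indices is a functional on the dual.  If [u (s j)] is not
    small at [x (t j)], Rosenthal's lemma yields such a set on which this functional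
    is bounded below along a subsequence of [u]. *)
Lemma weakly_null_unif_small (u : nat -> dual X) : weakly_null u ->
  forall d : R, 0 < d ->
  exists N, forall m n, (N <= m)%N -> rnorm (u m (x n)) < d.
Proof.
move=> u0 d d0.
have col n : u m (x n) @[m --> \oo] --> (0 : K^o).
  have [phi phiE] := evaluation (x n).
  by under eq_fun do rewrite -phiE; exact: u0.
have cols N : exists N', forall m n,
    (N' <= m)%N -> (n < N)%N -> rnorm (u m (x n)) < d.
  elim: N => [|N [N1 IH]]; first by exists 0%N.
  have [N2 N2d] := (cvg_rnorm0P _).1 (col N) d d0.
  exists (maxn N1 N2) => m n; rewrite geq_max => /andP[m1 m2].
  by rewrite ltnS leq_eqVlt => /orP[/eqP ->|]; [exact: N2d|exact: IH].
apply: contrapT => /forallNP nN.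
(* Every column tends to zero, so large entries occur in arbitrarily late columns. *)
have [s [t [sI tI std]]] : exists s t : nat -> nat,
    [/\ injective s, injective t & forall j, d <= rnorm (u (s j) (x (t j)))].
  apply: (@infinitely_often_injection (fun m n => d <= rnorm (u m (x n)))) => N.
  have [N' N'd] := cols N.
  have /existsNP[m /existsNP[n /not_implyP[Nm /negP]]] := nN (maxn N N').
  rewrite -leNgt => dmn; exists m, n; split=> //.
    by apply: leq_trans Nm; exact: leq_maxl.
  rewrite leqNgt; apply/negP => /(N'd m n (leq_trans (leq_maxr _ _) Nm)).
  by rewrite ltNge dmn.
have [C C0 uC] : exists2 C : R, 0 <= C & forall m, rnorm (u m) <= C.
  apply: weakly_bounded_bounded => phi.
  have /cvg_seq_bounded : cvgn (fun n => phi (u n)).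
    by apply/cvg_ex; exists 0; exact: u0.
  move=> /pinfty_ex_gt0[B B0 uB]; exists (toR B) => n.
  by rewrite ler_rnorm_ofR toRK ?(ltW B0)//; exact: uB.
have sub (r : nat -> nat) (f : dual X) N : injective r ->
    \sum_(i < N) rnorm (f (x (r i))) <= M * rnorm f.
  exact: (ler_sum_inj _ (fun i => rnorm_ge0 (f (x i))) (xM f)).
have d2 : 0 < d / 2 by rewrite divr_gt0.
pose a j i := rnorm (u (s j) (x (t i))).
have [||r rI rd] := @rosenthal R a (M * C) _ d2.
- by move=> j i; exact: rnorm_ge0.
- by move=> j N; apply: le_trans (sub t (u (s j)) N tI) _; rewrite ler_wpM2l.
have /choice[ev evP] : forall j, exists phi : dual (dual X),
    forall f, phi f = f (x (t (r j))) by move=> j; exact: evaluation.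
have [|psi psiP] := @dual_series R k (dual X) ev M M0.
  move=> f N; under eq_bigr do rewrite evP.
  by apply: (sub (t \o r)); exact: inj_comp.
have [N Nd] := (cvg_rnorm0P _).1 (u0 psi) (d / 2) d2.
have [j Nj] := injection_unbounded N (inj_comp sI rI).
have := Nd _ Nj; rewrite ltNge => /negP; apply.
apply: rnorm_limit_ge (psiP _) _; exists j.+1 => n jn.
rewrite (bigD1 (Ordinal jn))//= evP.
set off := \sum_(i < n | _) _.
have offle : rnorm off <= d / 2.
  apply: le_trans (ler_rnorm_sum _ _ _) _; apply: le_trans (rd j n).
  by under eq_bigr do rewrite evP.
have := std (r j); have := ler_rnormB (u (s (r j)) (x (t (r j))) + off) off.
rewrite addrK; move: offle.
set b := rnorm _; set b' := rnorm _; set b'' := rnorm _; lra.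
Qed.

(** This is the Dunford-Pettis property of [c0], transported to [X]. *)
Lemma unif_summable_dunford_pettis : dunford_pettis_set (range x).
Proof.
split.
  have [C C0 xC] : exists2 C : R, 0 <= C & forall n, rnorm (x n) <= C.
    apply: weakly_bounded_bounded => f; exists (M * rnorm f) => n.
    exact: (ler_sum_term n (fun i => rnorm_ge0 (f (x i))) (xM f)).
  by apply/bounded_set_rnormP; exists C => // _ [n _ <-].
move=> u u0 P /uniform_nbhs[E [entE EP]].
move: entE; rewrite -entourage_ballE => -[e /= /ofRK_gt0[d d0 de] eE].
have [N Nd] := weakly_null_unif_small u0 d0.
exists N => // m /= Nm; apply: EP => _ [n _ <-]; apply: eE => /=.
rewrite -ball_normE /= sub0r normrN -de -[`|_|]ofR_rnorm ltr_ofR.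
exact: Nd.
Qed.

End UniformlySummable.

(** * Right sets *)

Section RightSets.
Variables (R : realType) (k : scalar_kind) (X : normedModType (scalars R k)).
Local Notation K := (scalars R k).
Implicit Types (A : set (dual X)) (x : nat -> X).

Lemma sup_functionals_le A (y : X) (M : R) : 0 <= M ->
  (forall f, A f -> rnorm f <= M) ->
  0 <= sup [set rnorm (f y) | f in A] <= M * rnorm y.
Proof.
move=> M0 AM; have [[f Af]|nA] := pselect (exists f, A f); last first.
  have -> : [set rnorm (f y) | f in A] = set0.
    by apply/seteqP; split=> // z [f Af _]; case: nA; exists f.
  by rewrite sup0 lexx mulr_ge0// rnorm_ge0.
have yM : ubound [set rnorm (f y) | f in A] (M * rnorm y).
  move=> _ [g Ag <-]; apply: le_trans (dual_bound _ _) _.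
  by rewrite ler_wpM2r ?rnorm_ge0// AM.
apply/andP; split; last by apply: ge_sup => //; exists (rnorm (f y)), f.
apply: le_trans (rnorm_ge0 (f y)) _; apply: ub_le_sup; last by exists f.
by exists (M * rnorm y).
Qed.

Lemma norm_null_sup_functionals A x : bounded_set A ->
  x n @[n --> \oo] --> (0 : X) ->
  sup [set rnorm (f (x n)) | f in A] @[n --> \oo] --> (0 : R).
Proof.
move=> /bounded_set_rnormP[M M0 AM] /cvg_rnorm0P x0; apply/cvg_realP => e e0.
have M1 : 0 < M + 1 by lra.
have [N xN] := x0 (e / (M + 1)) (divr_gt0 e0 M1).
exists N => n /xN; rewrite ltr_pdivlMr// => xe.
have /andP[s0 sM] := sup_functionals_le (x n) M0 AM.
rewrite subr0 ger0_norm//; apply: le_lt_trans sM _.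
by have := rnorm_ge0 (x n); move: xe; set a := rnorm _; lra.
Qed.

Lemma rnorm_le_sup_unit_ball (y : X) :
  rnorm y <= sup [set rnorm (f y) | f in [set f : dual X | rnorm f <= 1]].
Proof.
have [f f1 <-] := norming_functional y; apply: ub_le_sup; last by exists f.
exists (1 * rnorm y) => _ [g g1 <-]; apply: le_trans (dual_bound _ _) _.
by rewrite ler_wpM2r ?rnorm_ge0.
Qed.

Lemma weakly_1summable_bounded x : weakly_summable 1%E x ->
  forall f : dual X, exists B, forall N, \sum_(i < N) rnorm (f (x i)) <= B.
Proof.
move=> xs f; have /cvg_seq_bounded/bounded_fun_has_ubound[B BP] := xs f.
exists B => N; have := BP _ (ex_intro2 _ _ N I erefl).
rewrite /series /= big_mkord; apply: le_trans; apply: ler_sum => i _.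
by rewrite powRr1// rnorm_ge0.
Qed.

(** The unit vectors of a copy of [c0] form a Right null sequence that is bounded
    away from zero. *)
Lemma DPrcP_no_c0 (p : \bar R) : (1 < p)%E -> DPrcP p X -> ~ contains_c0 X.
Proof.
move=> p1 dpr [T [cT [_ /ofRK_gt0[c c0 <-] cle]]].
have [M M0 TM] := continuous_linear_bound cT.
have [e eP] := unit_vectors R k.
have xM := c0_image_weakly_summable eP M0 TM.
have /cvg_rnorm0P/(_ c c0)[N Nc] : T (e n) @[n --> \oo] --> (0 : X).
  apply: dpr; split; first exact: unif_summable_weakly_summable xM _ p1.
  exact: unif_summable_dunford_pettis M0 xM.
have := Nc N (leqnn N); rewrite ltNge => /negP; apply.
have := cle (e N); rewrite -!ofR_rnorm -ofRM ler_ofR; apply: le_trans.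
rewrite -[leLHS]mulr1 ler_wpM2l ?(ltW c0)//.
have := c0_coord_le (e N) N; rewrite eP eqxx; apply: le_trans.
by rewrite rnorm1.
Qed.

End RightSets.

Theorem theorem4p7 (R : realType) (k : scalar_kind) (p : \bar R)
    (X : completeNormedModType (scalars R k)) (hp : (1 < p)%E) :
  DPrcP p X <-> SR 1%E p X /\ ~ contains_c0 X.
Proof.
split=> [dpr|[sr nc0]].
  split; last exact: DPrcP_no_c0 hp dpr.
  move=> A [bA _]; split=> // x /dpr; exact: norm_null_sup_functionals.
(* The (SR) property is applied to the dual unit ball, which norms [X]. *)
have bB : bounded_set [set f : dual X | rnorm f <= 1].
  by apply/bounded_set_rnormP; exists 1.
have /sr[_ supB] : right_set 1%E [set f : dual X | rnorm f <= 1].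
  split=> // x [xs _]; apply: norm_null_sup_functionals => //.
  exact: bessaga_pelczynski nc0 (weakly_1summable_bounded xs).
move=> x /supB/cvg_realP sup0; apply/cvg_rnorm0P => e /sup0[N Ne].
exists N => n /Ne; rewrite subr0; apply: le_lt_trans.
by apply: le_trans (ler_norm _); exact: rnorm_le_sup_unit_ball.
Qed.
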